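(* Let $k$ be an algebraically closed field. For every projective variety $\mathcal{V}$ over $k$ there exist natural numbers $n,a,b$ and a reduced matrix pencil $P=(a,b;\alpha_1,\dots,\alpha_n)$ over $k$ whose eigenvector variety $\epsilon(P)$ is isomorphic to $\mathcal{V}$ (as a projective variety).
   Context: A projective variety over $k$ means a Zariski closed subset of some projective space over $k$ (not necessarily irreducible). A matrix pencil $P=(a,b;\alpha_1,\dots,\alpha_n)$ over $k$ is given by $n$ linear transformations $\alpha_i\colon k^a\to k^b$, $i=1,\dots,n$ (equivalently, $n$ matrices of size $b\times a$ with coefficients in $k$). $P$ is called reduced if $\bigcap_{i=1}^n \operatorname{Ker}(\alpha_i)=0$. If $P$ is reduced, a vector $v\in k^a$ is called an eigenvector of $P$ if the subspace $\langle\alpha_1(v),\dots,\alpha_n(v)\rangle$ of $k^b$ generated by $\alpha_1(v),\dots,\alpha_n(v)$ is $1$-dimensional. Two eigenvectors are equivalent if they are (non-zero) scalar multiples of each other. The set $\epsilon(P)$ of equivalence classes of eigenvectors of $P$ is a Zariski closed subset of the projective space $\mathbb{P}(k^a)$ of one-dimensional subspaces of $k^a$, thus a projective variety; it is called the eigenvector variety of $P$. *)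

(* Defs.v *)
From HB Require Import structures.
From mathcomp Require Import all_boot all_order all_algebra.
From mathcomp Require Import mpoly ring.

Set Implicit Arguments.
Unset Strict Implicit.
Unset Printing Implicit Defensive.

Import GRing.Theory.
Local Open Scope ring_scope.

(* The projective space P(k^r) of one-dimensional subspaces of k^r, so that
   the usual P^m is [proj k m.+1]. *)
Definition proj (k : fieldType) (r : nat) : Type :=
  {L : {vspace 'cV[k]_r} | \dim L == 1%N}.

Definition eval_at (k : fieldType) (r : nat) (p : {mpoly k[r]})
  (v : 'cV[k]_r) : k := p.@[fun i => v i 0].

Definition vanishes_at (k : fieldType) (r : nat) (p : {mpoly k[r]})
  (x : proj k r) : Prop := forall v, v \in val x -> eval_at p v = 0.

Definition zariski_closed (k : fieldType) (r : nat) (Z : proj k r -> Prop)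
  : Prop :=
  exists2 S : {mpoly k[r]} -> Prop,
    (forall p, S p -> exists d, p \is d.-homog) &
    forall x, Z x <-> (forall p, S p -> vanishes_at p x).

Definition zariski_open (k : fieldType) (r : nat) (U : proj k r -> Prop)
  : Prop := zariski_closed (fun x => ~ U x).

Record projective_variety (k : fieldType) (r : nat) := ProjectiveVariety {
  variety_set : proj k r -> Prop;
  variety_closed : zariski_closed variety_set }.

Definition points (k : fieldType) (r : nat) (V : projective_variety k r)
  : Type := {x : proj k r | variety_set V x}.

Definition line_of (k : fieldType) (r : nat) (V : projective_variety k r)
  (x : points V) : {vspace 'cV[k]_r} := val (sval x).

(* Morphisms are the maps given, locally for the Zariski topology, by
   [v] |-> [F_1(v) : ... : F_s(v)] with F_1, ..., F_s forms of one and the same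
   degree. That the F_i have no common zero on the neighbourhood U need not be
   required separately: the line spanned by (F_1(v), ..., F_s(v)) is there equal
   to a point of P(k^s), hence of dimension 1. *)
Definition is_morphism (k : fieldType) (r s : nat)
  (V : projective_variety k r) (W : projective_variety k s)
  (f : points V -> points W) : Prop :=
  forall x : points V,
  exists (U : proj k r -> Prop) (d : nat) (F : 'I_s -> {mpoly k[r]}),
    [/\ zariski_open U, U (sval x), forall i, F i \is d.-homog &
      forall y : points V, U (sval y) ->
      forall v : 'cV[k]_r, line_of y = <[v]>%VS ->
        line_of (f y) = <[\col_i eval_at (F i) v]>%VS].

Definition isomorphic (k : fieldType) (r s : nat)
  (V : projective_variety k r) (W : projective_variety k s) : Prop :=
  exists (f : points V -> points W) (g : points W -> points V),
    [/\ is_morphism f, is_morphism g, cancel f g & cancel g f].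

Definition pencil (k : fieldType) (n a b : nat) : Type :=
  'I_n -> 'Hom('cV[k]_a, 'cV[k]_b).

Definition reduced (k : fieldType) (n a b : nat) (P : pencil k n a b) : Prop :=
  (\bigcap_(i < n) lker (P i))%VS = 0%VS.

Definition eigenvector (k : fieldType) (n a b : nat) (P : pencil k n a b)
  (v : 'cV[k]_a) : Prop :=
  \dim <<[seq P i v | i <- enum 'I_n]>>%VS = 1%N.

(* The equivalence class of an eigenvector v is recorded as the line <[v]>. *)
Definition eigenvector_set (k : fieldType) (n a b : nat) (P : pencil k n a b)
  (x : proj k a) : Prop :=
  exists2 v, eigenvector P v & val x = <[v]>%VS.

Section EigenvectorSetClosed.

Variables (k : fieldType) (n a b : nat) (P : pencil k n a b).

Let form (i : 'I_n) (s : 'I_b) : {mpoly k[a]} :=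
  \sum_(c < a) P i (delta_mx c 0) s 0 *: 'X_c.

Let minor (i j : 'I_n) (s t : 'I_b) : {mpoly k[a]} :=
  form i s * form j t - form j s * form i t.

Let eval_form i s v : eval_at (form i s) v = P i v s 0.
Proof.
rewrite /eval_at /form [in RHS](matrix_sum_delta v) raddf_sum /=.
rewrite linear_sum /= summxE; apply: eq_bigr => c _.
by rewrite big_ord1 mevalZ mevalXU linearZ /= mxE mulrC.
Qed.

Let eval_minor i j s t v :
  eval_at (minor i j s t) v
  = P i v s 0 * P j v t 0 - P j v s 0 * P i v t 0.
Proof. by rewrite -!eval_form /eval_at mevalB !mevalM. Qed.

Let form_homog i s : form i s \is 1.-homog.
Proof.
by apply: rpred_sum => c _; apply: rpredZ; rewrite dhomogX /= mdeg1.
Qed.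

Let minor_homog i j s t : minor i j s t \is 2.-homog.
Proof. by apply: rpredB; rewrite -[2%N]/(1 + 1)%N; apply: dhomogM. Qed.

Lemma eigenvector_set_closed :
  reduced P -> zariski_closed (eigenvector_set P).
Proof.
move=> redP.
exists (fun p => exists i j s t, p = minor i j s t).
  by move=> _ [i [j [s [t ->]]]]; exists 2%N.
case=> L /= dimL; have [v Lv]: exists v, L = <[v]>%VS.
  exists (vpick L); apply/esym/eqP; rewrite eqEdim dim_vline vpick0 -memvE.
  by rewrite memv_pick (eqP dimL) -dimv_eq0 (eqP dimL).
have nz_v: v != 0 by move: dimL; rewrite Lv dim_vline; case: (v != 0).
split=> [[w eig_w Lw] _ [i [j [s [t ->]]]] u|minor0].
  rewrite /= in Lw *; rewrite Lw => /vlineP[c ->].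
  rewrite eval_minor.
  rewrite /eigenvector in eig_w; set D := <<_>>%VS in eig_w.
  have inD l : P l w \in D.
    by apply: memv_span; apply: map_f; rewrite mem_enum.
  have [e De]: exists e, D = <[e]>%VS.
    exists (vpick D); apply/esym/eqP; rewrite eqEdim dim_vline vpick0 -memvE.
    by rewrite memv_pick [\dim D]eig_w -dimv_eq0 [\dim D]eig_w.
  have /vlineP[x Px]: P i w \in <[e]>%VS by rewrite -De.
  have /vlineP[y Py]: P j w \in <[e]>%VS by rewrite -De.
  by rewrite !linearZ /= Px Py !mxE; ring.
exists v => //; rewrite /eigenvector; set D := <<_>>%VS.
have [i nz_i]: exists i, P i v != 0.
  apply/existsP; apply: contraNT nz_v => /existsPn P0.
  rewrite -memv0 -redP memvE; apply/subv_bigcapP => i _.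
  by rewrite -memvE memv_ker; apply: negbNE (P0 i).
have [s nz_s]: exists s, P i v s 0 != 0.
  apply/existsP; apply: contraNT nz_i => /existsPn P0.
  by apply/eqP/colP => s; rewrite mxE; apply/eqP/negbNE/P0.
suff ->: D = <[P i v]>%VS by rewrite dim_vline nz_i.
apply: subv_anti; apply/andP; split; last first.
  by rewrite -memvE; apply: memv_span; apply: map_f; rewrite mem_enum.
apply/span_subvP => _ /mapP[j _ ->]; apply/vlineP.
exists (P j v s 0 / P i v s 0); apply/colP => t; rewrite mxE.
have /(_ v) := minor0 _ (ex_intro _ i (ex_intro _ j (ex_intro _ s
  (ex_intro _ t erefl)))).
rewrite /= Lv memv_line eval_minor => /(_ isT)/eqP.
rewrite subr_eq0 => /eqP E.
by rewrite mulrAC -E mulrAC mulfV // mul1r.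
Qed.

End EigenvectorSetClosed.

Definition eigenvector_variety (k : fieldType) (n a b : nat)
  (P : pencil k n a b) (redP : reduced P) : projective_variety k a :=
  ProjectiveVariety (eigenvector_set_closed redP).

(* Main.v *)
Require Import Defs.
From mathcomp Require Import all_boot all_order all_algebra.
From mathcomp Require Import boolp mpoly.

Set Implicit Arguments.
Unset Strict Implicit.
Unset Printing Implicit Defensive.

Import GRing.Theory Order.TTheory.
Local Open Scope ring_scope.

(** The eigenvectors of a pencil are cut out by rank conditions, and the
    Veronese variety is the classical example of a variety cut out by rank
    conditions: a nonzero symmetric tensor y of order d = D+1 on k^r is a
    multiple of a power lam^d of a vector exactly when its contractions y_i
    along the r coordinates (the rows of its first catalecticant matrix) span a
    line.  The contractions thus form a pencil, and its symmetric eigenvectors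
    are the points of the d-uple Veronese embedding of P(k^r).

    Given a closed set V in P(k^r), take d large enough for V to be cut out by
    forms of degree d alone ([forms_of_one_degree]); this is the finiteness
    supplied by the Hilbert basis theorem, and it is obtained here from Dickson's
    lemma applied to leading monomials.  A form of degree d on k^r is a linear
    form on tensors, so V becomes a linear section of the Veronese variety: the
    tensors killed by one matrix B, whose kernel also forces symmetry
    ([veronese_equations]).

    The condition B y = 0 is itself turned into a rank condition
    ([veronese_pencil]): add to the maps y |-> (y_i, 0) the map y |-> (0, B y),
    with values in a complementary block.  If y is an eigenvector, some y_i is
    nonzero, so (y_i, 0) spans the line of all the values; (0, B y) lies on that
    line only if B y = 0.  Hence the eigenvectors are the nonzero multiples of
    the powers lam^d with [lam] in V ([eigenvector_veronese],
    [veronese_eigenvector]).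

    Finally lam |-> lam^d is given by the monomials of degree d, and its inverse
    by the linear forms y |-> (y_(j :: w))_j where the word w is such that they
    do not all vanish; both are morphisms ([veronese_pencil_isomorphic]). *)

(** * Forms of one degree cut out a closed set *)

(** Dickson's lemma, for a type measured by finitely many natural-valued
    functions instead of for the monomials themselves, so that it applies
    directly to polynomials through the exponents of their leading monomials.
    The induction drops the first function c: the elements whose c-value is at
    least that of the finite set B found without c are dominated by B, and the
    others fall into finitely many slices on which c is constant. *)
Lemma dickson (T : eqType) (cs : seq (T -> nat)) (A : T -> Prop) :
  exists2 B : seq T, (forall b, b \in B -> A b) &
    forall a, A a ->
      exists2 b, b \in B & all (fun c : T -> nat => c b <= c a)%N cs.
Proof.
elim: cs A => [|c cs IH] A.
  have [[a0 Aa0]|A0] := pselect (exists a, A a).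
    exists [:: a0] => [b|a _]; first by rewrite inE => /eqP->.
    by exists a0; rewrite ?mem_head.
  by exists [::] => // a Aa; case: A0; exists a.
have [B BA domB] := IH A.
have [C CA domC] : exists2 C : seq T, (forall b, b \in C -> A b) &
    forall a, A a -> (c a < \max_(b <- B) c b)%N ->
      exists2 b, b \in C & all (fun h : T -> nat => h b <= h a)%N (c :: cs).
  elim: (\max_(b <- B) c b)%N => [|M [C CA domC]]; first by exists [::].
  have [C' C'A domC'] := IH (fun a => A a /\ c a = M).
  exists (C ++ C') => [b|a Aa]; first by rewrite mem_cat => /orP[/CA|/C'A[]].
  rewrite ltnS leq_eqVlt => /predU1P[caM|/(domC a Aa)[b Cb dom]]; last first.
    by exists b; rewrite // mem_cat Cb.
  have [b C'b dom] := domC' a (conj Aa caM).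
  have [_ cbM] := C'A b C'b.
  by exists b; rewrite ?mem_cat ?C'b ?orbT //= cbM caM leqnn.
exists (B ++ C) => [b|a Aa]; first by rewrite mem_cat => /orP[/BA|/CA].
have [ltM|geM] := ltnP (c a) (\max_(b <- B) c b).
  by have [b Cb dom] := domC a Aa ltM; exists b; rewrite // mem_cat Cb orbT.
have [b Bb dom] := domB a Aa.
exists b; rewrite ?mem_cat ?Bb //= dom andbT.
by apply: leq_trans geM; apply: (leq_bigmax_seq b Bb isT).
Qed.

Lemma nz_col_entry (k : fieldType) (n : nat) (v : 'cV[k]_n) :
  v != 0 -> exists i, v i 0 != 0.
Proof.
move=> v0; apply/existsP; apply: contraNT v0 => /existsPn v0.
by apply/eqP/colP => i; rewrite mxE; apply/eqP/negbNE/v0.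
Qed.

Section Forms.
Variables (k : fieldType) (r : nat).
Implicit Types (p g : {mpoly k[r]}) (v : 'cV[k]_r).

Lemma eval_at_homogZ d p c v :
  p \is d.-homog -> eval_at p (c *: v) = c ^+ d * eval_at p v.
Proof.
move=> /dhomogP homp; rewrite /eval_at !mevalE big_distrr /=.
rewrite [LHS]big_seq [RHS]big_seq; apply: eq_bigr => m /homp /= degm.
rewrite mulrCA -degm mdegE -prodrXr -big_split /=.
by congr (_ * _); apply: eq_bigr => i _; rewrite mxE exprMn.
Qed.

Lemma proj_line (x : proj k r) : exists2 v, v != 0 & val x = <[v]>%VS.
Proof.
case: x => L /= dimL; exists (vpick L).
  by rewrite vpick0 -dimv_eq0 (eqP dimL).
apply/esym/eqP; rewrite eqEdim dim_vline vpick0 -memvE.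
by rewrite memv_pick (eqP dimL) -dimv_eq0 (eqP dimL).
Qed.

Lemma vanishes_at_line d p (x : proj k r) v :
  p \is d.-homog -> val x = <[v]>%VS -> vanishes_at p x <-> eval_at p v = 0.
Proof.
move=> homp xv; rewrite /vanishes_at xv; split=> [->//|p0 w /vlineP[c ->]].
  exact: memv_line.
by rewrite (eval_at_homogZ _ _ homp) p0 mulr0.
Qed.

Lemma mdeg_mlead_homog d p : p != 0 -> p \is d.-homog -> mdeg (mlead p) = d.
Proof. by move=> p0 homp; apply: (dhomog_mf homp); apply: mlead_supp. Qed.

(** One step of division: the leading terms cancel.  The quotient of the leading
    terms has the complementary degree, so the remainder stays homogeneous. *)
Lemma homog_division_step d p g (m := (mlead p - mlead g)%MM)
  (c := p@_(mlead p) / g@_(mlead g)) :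
  p != 0 -> g != 0 -> p \is d.-homog -> (exists e, g \is e.-homog) ->
  (mlead g <= mlead p)%MM ->
  let q := p - c *: ('X_[m] * g) in
  q \is d.-homog /\ (q = 0 \/ (mlead q < mlead p)%O).
Proof.
move=> p0 g0 homp [e homg] le_gp q.
have gc0 : g@_(mlead g) != 0 by rewrite mleadc_eq0.
have pc0 : p@_(mlead p) != 0 by rewrite mleadc_eq0.
have c0 : c != 0 by rewrite mulf_neq0 ?invr_eq0.
have X0 : 'X_[k, m] != 0 :> {mpoly k[r]}.
  by rewrite -mleadc_eq0 mleadXm mcoeffX eqxx oner_eq0.
have leadXg : mlead ('X_[m] * g) = mlead p by rewrite mleadM // mleadXm submK.
have homq : q \is d.-homog.
  apply: rpredB => //; apply: rpredZ.
  have : 'X_[m] * g \is (mdeg m + e).-homog.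
    by apply: dhomogM => //; rewrite dhomogX.
  suff -> : (mdeg m + e)%N = d by [].
  rewrite -(mdeg_mlead_homog g0 homg) -mdegD submK //.
  exact: mdeg_mlead_homog homp.
split=> //; have [->|q0] := eqVneq q 0; [by left|right].
have qp : q@_(mlead p) = 0.
  have := mleadcM 'X_[m] g; rewrite mleadXm mcoeffX eqxx mul1r submK // => Xgc.
  by rewrite mcoeffB mcoeffZ Xgc /c mulfVK // subrr.
rewrite lt_neqAle; apply/andP; split.
  by apply: contraNneq q0 => eqpq; rewrite -mleadc_eq0 eqpq qp.
apply: le_trans (mleadB_le _ _) _.
by rewrite mleadZ // leadXg joinxx.
Qed.

(** The finiteness that the Hilbert basis theorem provides.  By Dickson's lemma
    there is a finite set G of nonzero forms vanishing on Z such that the leading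
    monomial of each of these forms is divisible by that of an element of G.  By
    repeated division, a point where all elements of G vanish lies in Z.  With D
    the largest degree in G, the elements of G are brought to degree D+1 by powers
    of the coordinates, which do not all vanish at a point of projective space. *)
Lemma forms_of_one_degree (Z : proj k r -> Prop) : zariski_closed Z ->
  exists D, forall x, (forall p, p \is D.+1.-homog ->
    (forall z, Z z -> vanishes_at p z) -> vanishes_at p x) -> Z x.
Proof.
move=> [S homS defZ].
pose I p := [/\ p != 0, exists d, p \is d.-homog &
                forall z, Z z -> vanishes_at p z].
have [G GI domG] := dickson [seq (fun p => mlead p i) | i <- enum 'I_r] I.
pose D := (\max_(g <- G) mdeg (mlead g))%N.
exists D => x vanx; apply/defZ.
have [v v0 xv] := proj_line x.
have [i vi0] := nz_col_entry v0.
have vanG g : g \in G -> eval_at g v = 0.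
  move=> Gg; have [g0 [e homg] vang] := GI g Gg.
  have le_eD : (e <= D)%N.
    rewrite -(mdeg_mlead_homog g0 homg).
    exact: (leq_bigmax_seq g Gg isT).
  have homXg : 'X_i ^+ (D.+1 - e) * g \is D.+1.-homog.
    rewrite -[X in X.-homog](subnK (leqW le_eD)); apply: dhomogM => //.
    by rewrite -[X in X.-homog]mul1n; apply: dhomogMn; rewrite dhomogX /= mdeg1.
  have := vanx _ homXg; rewrite (vanishes_at_line homXg xv) => /(_ _)/eqP.
  rewrite /eval_at mevalM rmorphXn /= mevalXU mulf_eq0 expf_eq0 (negPf vi0) andbF.
  move=> /(_ _)/eqP; apply=> z Zz w zw.
  by rewrite /eval_at mevalM [X in _ * X](vang z Zz w zw) mulr0.
suff van p d : p \is d.-homog -> (forall z, Z z -> vanishes_at p z) ->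
    eval_at p v = 0.
  move=> p Sp; have [d homp] := homS p Sp.
  rewrite (vanishes_at_line homp xv); apply: (van p d homp) => z /defZ; exact.
(* The monomial order is well founded, which ends the divisions. *)
move: {-1}(mlead p) (erefl (mlead p)) => m.
elim/(@ltmwf r): m p => m IH p leadp homp vanp.
have [->|p0] := eqVneq p 0; first by rewrite /eval_at meval0.
have [|g Gg] := domG p; first by split=> //; exists d.
move=> /allP dom; have [g0 homg vang] := GI g Gg.
have le_gp : (mlead g <= mlead p)%MM.
  apply/mnm_lepP => j; apply: (dom (fun p => mlead p j)).
  by apply: map_f; rewrite mem_enum.
have [] := homog_division_step p0 g0 homp homg le_gp.
set q := p - _ => homq leadq.
have -> : eval_at p v = eval_at q v.
  rewrite /eval_at mevalB mevalZ mevalM.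
  by rewrite [X in _ * (_ * X)](vanG g Gg) !mulr0 subr0.
case: leadq => [->|lt_qp]; first by rewrite /eval_at meval0.
apply: (IH (mlead q)) => //; first by rewrite -leadp.
move=> z Zz w zw; rewrite /eval_at mevalB mevalZ mevalM.
rewrite [X in X - _](vanp z Zz w zw) [X in _ * (_ * X)](vang z Zz w zw).
by rewrite !mulr0 subr0.
Qed.

End Forms.

(** * Linear systems and lines *)

(** Infinitely many linear equations in n unknowns are equivalent to n of them:
    as long as an equation does not follow from the rows of B, adding it to them
    increases the rank, which is at most n. *)
Lemma finite_linear_system (k : fieldType) (n : nat) (E : 'rV[k]_n -> Prop) :
  exists B : 'M[k]_n,
    forall y : 'cV_n, B *m y = 0 <-> (forall u, E u -> u *m y = 0).
Proof.
suff H m (B : 'M[k]_n) : (n - \rank B <= m)%N ->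
    (forall y : 'cV_n, (forall u, E u -> u *m y = 0) -> B *m y = 0) ->
    exists B : 'M[k]_n,
      forall y : 'cV_n, B *m y = 0 <-> (forall u, E u -> u *m y = 0).
  by apply: (H n 0); [rewrite leq_subr | move=> y _; rewrite mul0mx].
elim: m B => [|m IH] B rkB solB.
  exists B => y; split=> [By0 u _|/solB//].
  have /submxP[C ->] : (u <= B)%MS.
    apply: submx_full; rewrite /row_full eqn_leq rank_leq_col.
    by rewrite -subn_eq0 -leqn0.
  by rewrite -mulmxA By0 mulmx0.
have [[u Eu uB]|allB] := pselect (exists2 u, E u & ~~ (u <= B)%MS); last first.
  exists B => y; split=> [By0 u Eu|/solB//].
  have /submxP[C ->] : (u <= B)%MS.
    by apply/negPn/negP => uB; apply: allB; exists u.
  by rewrite -mulmxA By0 mulmx0.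
apply: (IH (B + u)%MS).
  have : (B < B + u)%MS.
    by rewrite ltmxE addsmxSl addsmx_sub submx_refl.
  move/rank_ltmx => lt_rk.
  move: rkB; rewrite !leq_subLR => /leq_trans; apply.
  by rewrite addnS -addSn leq_add2r.
move=> y soly; apply/eqP; rewrite -sub_kermx addsmx_sub !sub_kermx.
by rewrite (solB y soly) (soly u Eu) !eqxx.
Qed.

Lemma vlineZ (k : fieldType) (vT : vectType k) (c : k) (v : vT) :
  c != 0 -> <[c *: v]>%VS = <[v]>%VS.
Proof.
move=> c0; apply/eqP; rewrite eqEsubv -!memvE rpredZ ?memv_line //=.
by apply/vlineP; exists c^-1; rewrite scalerK.
Qed.

Lemma eq_vlineP (k : fieldType) (vT : vectType k) (v w : vT) :
  <[v]>%VS = <[w]>%VS -> exists2 c, c != 0 & v = c *: w.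
Proof.
move=> vw; have /vlineP[c vcw] : v \in <[w]>%VS by rewrite -vw memv_line.
have [c0|c0] := eqVneq c 0; last by exists c.
have v0 : v = 0 by rewrite vcw c0 scale0r.
exists 1; rewrite ?oner_eq0 // scale1r v0; apply/esym/eqP.
have /vlineP[e ->] : w \in <[v]>%VS by rewrite vw memv_line.
by rewrite v0 scaler0.
Qed.

(** * Tensors indexed by words and the Veronese embedding *)

Section Veronese.
Variables (k : fieldType) (r : nat).

(** Coordinates are indexed by all words of length d in the r variables rather
    than by monomials of degree d: contraction just removes the first letter, and
    symmetry is imposed by linear equations. *)
Definition word_count (d : nat) := #|{: d.-tuple 'I_r}|.

Definition word d (i : 'I_(word_count d)) : d.-tuple 'I_r := enum_val i.

(** The row of the linear form y |-> y_s.  It makes sense for every list s, and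
    is zero unless s has length d; this avoids dependent lengths below. *)
Definition word_row d (s : seq 'I_r) : 'rV[k]_(word_count d) :=
  \row_i (word i == s :> seq _)%:R.

Definition coord d (y : 'cV[k]_(word_count d)) (s : seq 'I_r) : k :=
  (word_row d s *m y) 0 0.

Definition word_eval (v : 'cV[k]_r) (s : seq 'I_r) : k := \prod_(j <- s) v j 0.

Definition veronese d (v : 'cV[k]_r) : 'cV[k]_(word_count d) :=
  \col_i word_eval v (word i).

Definition contract d (i : 'I_r) : 'M[k]_(word_count d, word_count d.+1) :=
  \matrix_(a, b) word_row d.+1 (i :: word a) 0 b.

Lemma coordZ d c (y : 'cV_(word_count d)) s : coord (c *: y) s = c * coord y s.
Proof. by rewrite /coord -scalemxAr mxE. Qed.

Lemma coord_at d (y : 'cV_(word_count d)) i : coord y (word i) = y i 0.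
Proof.
rewrite /coord mxE (bigD1 i) //= mxE eqxx mul1r big1 ?addr0 // => j ji.
by rewrite mxE val_eqE (inj_eq enum_val_inj) (negPf ji) mul0r.
Qed.

Lemma word_index d (s : seq 'I_r) :
  size s = d -> exists i : 'I_(word_count d), s = word i.
Proof.
move=> /eqP sz; exists (enum_rank (Tuple sz)).
by rewrite /word enum_rankK.
Qed.

Lemma coord_inj d (y z : 'cV_(word_count d)) :
  (forall s, size s = d -> coord y s = coord z s) -> y = z.
Proof.
by move=> yz; apply/colP => i; rewrite -!coord_at yz ?size_tuple.
Qed.

Lemma coord_veronese d v s : size s = d -> coord (veronese d v) s = word_eval v s.
Proof. by move=> /word_index[i ->]; rewrite coord_at mxE. Qed.

Lemma coord_contract d i (y : 'cV_(word_count d.+1)) s :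
  size s = d -> coord (contract d i *m y) s = coord y (i :: s).
Proof.
move=> /word_index[a ->]; rewrite coord_at /coord !mxE.
by apply: eq_bigr => b _; rewrite mxE.
Qed.

Lemma word_evalZ c v s : word_eval (c *: v) s = c ^+ size s * word_eval v s.
Proof.
rewrite /word_eval; elim: s => [|i s IH]; first by rewrite !big_nil mul1r.
by rewrite !big_cons IH mxE exprS mulrACA.
Qed.

Lemma word_eval_nseq v i d : word_eval v (nseq d i) = v i 0 ^+ d.
Proof. by rewrite /word_eval big_nseq; elim: d => //= d ->; rewrite exprS. Qed.

Lemma veroneseZ d c v : veronese d (c *: v) = c ^+ d *: veronese d v.
Proof. by apply/colP => i; rewrite !mxE word_evalZ size_tuple. Qed.

Lemma veronese_neq0 d v : v != 0 -> veronese d v != 0.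
Proof.
move=> /nz_col_entry[i vi0]; apply: contraNneq vi0 => ver0.
have := coord_veronese v (size_nseq d i).
rewrite ver0 /coord mulmx0 mxE word_eval_nseq => /esym/eqP.
by rewrite expf_eq0 => /andP[].
Qed.

Lemma contract_veronese d i v :
  contract d i *m veronese d.+1 v = v i 0 *: veronese d v.
Proof.
apply: coord_inj => s sz.
rewrite coord_contract // coordZ !coord_veronese //= ?sz //.
by rewrite /word_eval big_cons.
Qed.

(** The contractions determine a tensor of positive order; this is what makes the
    pencil below reduced. *)
Lemma contract_eq0 d (y : 'cV_(word_count d.+1)) :
  (forall i, contract d i *m y = 0) -> y = 0.
Proof.
move=> y0; apply: coord_inj => -[//|i s] [sz].
by rewrite -coord_contract // y0 /coord !mulmx0.
Qed.

Definition symmetric_tensor d (y : 'cV_(word_count d)) :=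
  forall s t, perm_eq s t -> size s = d -> coord y s = coord y t.

Lemma word_eval_perm v s t : perm_eq s t -> word_eval v s = word_eval v t.
Proof. exact: perm_big. Qed.

(** The heart of the argument.  If the contractions of y are the multiples
    lam_i z of one tensor, then lam_i0 y_(i :: s) = lam_i y_(i0 :: s).  By
    symmetry this trades any letter i of a word for i0, at the cost of a factor
    lam_i / lam_i0; trading all of them gives y_s = c lam^s. *)
Lemma rank_one_veronese d (y : 'cV_(word_count d.+1)) z (lam : 'cV_r) :
  symmetric_tensor y -> y != 0 ->
  (forall i, contract d i *m y = lam i 0 *: z) ->
  lam != 0 /\ exists2 c, c != 0 & y = c *: veronese d.+1 lam.
Proof.
move=> symy y0 yz.
have lam0 : lam != 0.
  apply: contraNneq y0 => lam0; apply/eqP/contract_eq0 => i.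
  by rewrite yz lam0 mxE scale0r.
split=> //; have [i0 li0] := nz_col_entry lam0.
have ycons i s : size s = d -> coord y (i :: s) = lam i 0 * coord z s.
  by move=> sz; rewrite -coord_contract // yz coordZ.
(* The letters already traded are pushed to the end of the word, into t. *)
have swap s t : size (s ++ t) = d.+1 ->
    lam i0 0 ^+ size s * coord y (s ++ t)
    = word_eval lam s * coord y (nseq (size s) i0 ++ t).
  elim: s t => [|i s IH] t szst; first by rewrite /word_eval big_nil.
  have [szs] := szst.
  have symst : perm_eq (i0 :: s ++ t) (s ++ i0 :: t).
    by rewrite -cat_rcons -cat1s catA perm_cat2r perm_catC cats1.
  have swap1 : lam i0 0 * coord y (i :: s ++ t)
             = lam i 0 * coord y (s ++ i0 :: t).
    by rewrite -(symy _ _ symst) /= ?szs // !ycons // mulrCA.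
  rewrite /= exprSr -mulrA swap1 mulrCA IH -?(perm_size symst) //.
  rewrite /word_eval big_cons mulrA; congr (_ * coord y _).
  by rewrite -[i0 :: t]cat1s -[RHS]/(nseq (size s).+1 i0 ++ t) -addn1 nseqD catA.
pose c := coord y (nseq d.+1 i0) / lam i0 0 ^+ d.+1.
have yc : y = c *: veronese d.+1 lam.
  apply: coord_inj => s sz; rewrite coordZ coord_veronese //.
  have := swap s [::]; rewrite !cats0 sz => /(_ erefl) eq_sc.
  apply: (mulfI (expf_neq0 d.+1 li0)); rewrite eq_sc mulrA.
  by rewrite [_ ^+ _ * c]mulrC mulfVK ?expf_neq0 // mulrC.
exists c => //; apply: contraNneq y0 => c0.
by rewrite yc c0 scale0r.
Qed.

Lemma monomial_word (m : 'X_{1..r}) :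
  exists2 s, size s = mdeg m &
    forall v : 'cV[k]_r, word_eval v s = \prod_i v i 0 ^+ m i.
Proof.
exists (flatten [seq nseq (m i) i | i <- enum 'I_r]).
  rewrite size_flatten /shape -map_comp sumnE big_map mdegE big_enum /=.
  by apply: eq_bigr => i _; rewrite size_nseq.
move=> v; rewrite /word_eval big_flatten big_map big_enum /=.
by apply: eq_bigr => i _; rewrite -word_eval_nseq.
Qed.

(** The linear form is not unique: any word spelling a monomial may carry its
    coefficient. *)
Lemma form_as_row d (p : {mpoly k[r]}) : p \is d.-homog ->
  exists u : 'rV[k]_(word_count d),
    forall v, u *m veronese d v = (eval_at p v)%:M.
Proof.
move=> /dhomogP homp.
have [wd wdP] : exists wd, forall m : 'X_{1..r},
    size (wd m) = mdeg m /\
    forall v : 'cV[k]_r, word_eval v (wd m) = \prod_i v i 0 ^+ m i.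
  have [|wd wdP] := @choice _ _ (fun (m : 'X_{1..r}) s => size s = mdeg m /\
    forall v : 'cV[k]_r, word_eval v s = \prod_i v i 0 ^+ m i).
    by move=> m; have [s] := monomial_word m; exists s.
  by exists wd.
exists (\sum_(m <- msupp p) p@_m *: word_row d (wd m)) => v.
apply/matrixP => i j; rewrite !ord1 mulmx_suml summxE mxE eqxx mulr1n.
rewrite /eval_at mevalE big_seq [RHS]big_seq; apply: eq_bigr => m /homp /= degm.
have [szw evw] := wdP m.
rewrite -scalemxAl mxE -evw; congr (_ * _).
by apply: coord_veronese; rewrite szw.
Qed.

(** Up to a scalar, nonzero if lam^w and c are, lam is recovered from a multiple
    of its power by fixing all letters of a word but the first. *)
Lemma coord_row_veronese D c lam w : size w = D ->
  \col_j coord (c *: veronese D.+1 lam) (j :: w) = (c * word_eval lam w) *: lam.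
Proof.
move=> szw; apply/colP => j; rewrite !mxE coordZ coord_veronese /= ?szw //.
by rewrite /word_eval big_cons mulrCA mulrC.
Qed.

Lemma veronese_line_inj D (lam mu : 'cV[k]_r) : lam != 0 ->
  <[veronese D.+1 lam]>%VS = <[veronese D.+1 mu]>%VS -> <[lam]>%VS = <[mu]>%VS.
Proof.
move=> lam0 /eq_vlineP[c c0 lammu]; have [i li0] := nz_col_entry lam0.
have szw := size_nseq D i.
have := coord_row_veronese 1 lam szw; rewrite scale1r lammu.
rewrite (coord_row_veronese _ _ szw) mul1r (word_eval_nseq lam).
have Li0 : lam i 0 ^+ D != 0 by rewrite expf_neq0.
move=> E; rewrite -(vlineZ lam Li0) -E vlineZ //.
apply: contraNneq lam0 => c0'; move/eqP: E.
by rewrite c0' scale0r eq_sym scaler_eq0 (negPf Li0).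
Qed.

Lemma veronese_lineZ d (lam mu : 'cV[k]_r) :
  <[lam]>%VS = <[mu]>%VS -> <[veronese d lam]>%VS = <[veronese d mu]>%VS.
Proof.
by move=> /eq_vlineP[c c0 ->]; rewrite veroneseZ vlineZ // expf_neq0.
Qed.

(** The symmetry relations y_s = y_t are among the linear equations satisfied by
    all the powers lam^d. *)
Lemma symmetric_tensor_of_veronese d (y : 'cV[k]_(word_count d)) :
  (forall u : 'rV_(word_count d),
     (forall lam, u *m veronese d lam = 0) -> u *m y = 0) ->
  symmetric_tensor y.
Proof.
move=> veq s t st sz; apply/eqP; rewrite -subr_eq0 /coord.
have entryB (M N : 'rV_(word_count d)) :
    (M *m y) 0 0 - (N *m y) 0 0 = ((M - N) *m y) 0 0.
  by rewrite mulmxBl [RHS]mxE [X in _ = _ + X]mxE.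
rewrite entryB veq ?mxE // => lam; apply/rowP => a; rewrite !ord1.
rewrite mulmxBl [LHS]mxE [X in _ + X]mxE [RHS]mxE.
rewrite -[X in X - _]/(coord _ s) -[X in _ - X]/(coord _ t).
by rewrite !coord_veronese -?(perm_size st) // (word_eval_perm _ st) subrr.
Qed.

(** * The pencil attached to a linear section of the Veronese variety *)

Section Pencil.
Variables (D : nat) (B : 'M[k]_(word_count D.+1)).

(** The values of the contractions and of B lie in complementary blocks, so that
    a value of B cannot be a nonzero multiple of a contraction. *)
Definition veronese_pencil :
    pencil k r.+1 (word_count D.+1) (word_count D + word_count D.+1) :=
  fun j => linfun (mulmx (if unlift ord0 j is Some i
                          then col_mx (contract D i) 0 else col_mx 0 B)).

Lemma veronese_pencil_lift i y :
  veronese_pencil (lift ord0 i) y = col_mx (contract D i *m y) 0.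
Proof. by rewrite /veronese_pencil liftK lfunE /= mul_col_mx mul0mx. Qed.

Lemma veronese_pencil0 y : veronese_pencil ord0 y = col_mx 0 (B *m y).
Proof. by rewrite /veronese_pencil unlift_none lfunE /= mul_col_mx mul0mx. Qed.

Lemma veronese_pencil_reduced : reduced veronese_pencil.
Proof.
apply/eqP; rewrite -subv0; apply/subvP => y ker_y; rewrite memv0; apply/eqP.
apply: contract_eq0 => i.
have : (\bigcap_(j < r.+1) lker (veronese_pencil j)
        <= lker (veronese_pencil (lift ord0 i)))%VS.
  exact: bigcapv_inf.
move=> /subvP/(_ y ker_y); rewrite memv_ker veronese_pencil_lift => /eqP.
by rewrite -(col_mx0 _ _ _) => /eq_col_mx[].
Qed.

Lemma veronese_eigenvector lam : lam != 0 -> B *m veronese D.+1 lam = 0 ->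
  eigenvector veronese_pencil (veronese D.+1 lam).
Proof.
move=> lam0 Blam; have [i li0] := nz_col_entry lam0.
have e0 : col_mx (veronese D lam) 0 != 0 :> 'cV_(word_count D + word_count D.+1).
  by rewrite col_mx_eq0 negb_and veronese_neq0.
have Pi j : veronese_pencil (lift ord0 j) (veronese D.+1 lam)
    = lam j 0 *: col_mx (veronese D lam) 0.
  by rewrite veronese_pencil_lift contract_veronese scale_col_mx scaler0.
rewrite /eigenvector; set S := <<_>>%VS.
suff -> : S = <[col_mx (veronese D lam) 0]>%VS by rewrite dim_vline e0.
apply/eqP; rewrite eqEsubv; apply/andP; split.
  apply/span_subvP => _ /mapP[j _ ->].
  case: (unliftP ord0 j) => [j' ->|->]; first by rewrite Pi rpredZ ?memv_line.
  by rewrite veronese_pencil0 Blam col_mx0 mem0v.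
rewrite -memvE -[X in X \in _](scalerK li0) -Pi rpredZ //.
by apply: memv_span; apply: map_f; rewrite mem_enum.
Qed.

(** Some contraction of y is nonzero, since the contractions determine y.  It
    spans the line of values, so the component B y in the other block is zero, and
    the contractions are proportional. *)
Lemma eigenvector_veronese y :
  (B *m y = 0 -> symmetric_tensor y) ->
  eigenvector veronese_pencil y ->
  B *m y = 0 /\
  exists2 lam, lam != 0 & exists2 c, c != 0 & y = c *: veronese D.+1 lam.
Proof.
move=> Bsym; rewrite /eigenvector; set S := <<_>>%VS => dimS.
have inS j : veronese_pencil j y \in S.
  by apply: memv_span; apply: map_f; rewrite mem_enum.
have y0 : y != 0.
  apply: contra_eq_neq dimS => y0; suff -> : S = 0%VS by rewrite dimv0.
  apply/eqP; rewrite -subv0; apply/span_subvP => _ /mapP[j _ ->].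
  by rewrite y0 linear0 mem0v.
have [i ny0] : exists i, contract D i *m y != 0.
  apply/existsP; apply: contraNT y0 => /existsPn all0.
  by apply/eqP/contract_eq0 => i; apply/eqP/negbNE/all0.
have SE : S = <[col_mx (contract D i *m y) 0]>%VS.
  apply/esym/eqP; rewrite eqEdim -memvE -veronese_pencil_lift inS /= dimS.
  by rewrite dim_vline veronese_pencil_lift col_mx_eq0 negb_and ny0.
have By0 : B *m y = 0.
  have := inS ord0; rewrite SE veronese_pencil0 => /vlineP[c].
  by rewrite scale_col_mx scaler0 => /eq_col_mx[].
split=> //.
pose z := contract D i *m y.
have [lam yz] : exists lam : 'cV_r, forall j, contract D j *m y = lam j 0 *: z.
  have [|f fP] := @choice _ _ (fun j c => contract D j *m y = c *: z).
    move=> j; have := inS (lift ord0 j).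
    rewrite SE veronese_pencil_lift => /vlineP[c].
    by rewrite scale_col_mx => /eq_col_mx[]; exists c.
  by exists (\col_j f j) => j; rewrite mxE.
have [lam0 yc] := rank_one_veronese (Bsym By0) y0 yz.
by exists lam.
Qed.

End Pencil.

Definition linear_form n (u : 'rV[k]_n) : {mpoly k[n]} := \sum_c u 0 c *: 'X_c.

Lemma linear_form_homog n (u : 'rV[k]_n) : linear_form u \is 1.-homog.
Proof. by apply: rpred_sum => c _; apply: rpredZ; rewrite dhomogX /= mdeg1. Qed.

Lemma eval_linear_form n (u : 'rV[k]_n) (y : 'cV_n) :
  eval_at (linear_form u) y = (u *m y) 0 0.
Proof.
rewrite /eval_at raddf_sum mxE; apply: eq_bigr => c _.
by rewrite /= mevalZ mevalXU.
Qed.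

Definition word_form (s : seq 'I_r) : {mpoly k[r]} := \prod_(j <- s) 'X_j.

Lemma word_form_homog s : word_form s \is (size s).-homog.
Proof.
rewrite /word_form; elim: s => [|j s IH]; first by rewrite big_nil dhomog1.
rewrite big_cons -[X in X.-homog]add1n.
by apply: dhomogM; rewrite // dhomogX /= mdeg1.
Qed.

Lemma eval_word_form s v : eval_at (word_form s) v = word_eval v s.
Proof.
rewrite /eval_at /word_form rmorph_prod /word_eval; apply: eq_bigr => j _.
exact: mevalXU.
Qed.

End Veronese.

(** * The isomorphism *)

Definition in_cone (k : fieldType) (r : nat) (Z : proj k r -> Prop)
  (lam : 'cV[k]_r) := exists2 z, Z z & val z = <[lam]>%VS.

Lemma points_inj (k : fieldType) (r : nat) (V : projective_variety k r)
  (x y : points V) : line_of x = line_of y -> x = y.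
Proof.
case: x y => [x Vx] [y Vy]; rewrite /line_of /= => /val_inj xy.
by case: y / xy Vy => Vy; congr exist; apply: Prop_irrelevance.
Qed.

Lemma in_cone_neq0 (k : fieldType) (r : nat) (Z : proj k r -> Prop) lam :
  in_cone Z lam -> lam != 0.
Proof.
case=> -[L dimL] _ /= Llam; move: dimL.
by rewrite Llam dim_vline; case: (lam != 0).
Qed.

Lemma zariski_open_neq0 (k : fieldType) (r d : nat) (p : {mpoly k[r]}) :
  p \is d.-homog -> zariski_open (fun x => ~ vanishes_at p x).
Proof.
move=> homp; exists (fun q => q = p) => [_ ->|x]; first by exists d.
split=> [/contrapT px _ ->//|]; by move=> /(_ p erefl) px; apply.
Qed.

Lemma zariski_openT (k : fieldType) (r : nat) :
  zariski_open (fun _ : proj k r => True).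
Proof.
exists (fun p => p = 1) => [_ ->|x]; first by exists 0%N; apply: dhomog1.
split=> [//|/(_ 1 erefl)/(_ 0 (mem0v _))/eqP].
by rewrite /eval_at meval1 oner_eq0.
Qed.

(** Every linear equation valid on the d-th powers of the points of Z holds on
    ker B: among these are the symmetry relations and the forms of degree d that
    vanish on Z. *)
Lemma veronese_equations (k : fieldType) (r : nat) (Z : proj k r -> Prop) :
  zariski_closed Z ->
  exists D (B : 'M[k]_(word_count r D.+1)),
    (forall y, B *m y = 0 -> symmetric_tensor y) /\
    (forall lam, lam != 0 -> B *m veronese D.+1 lam = 0 <-> in_cone Z lam).
Proof.
move=> /forms_of_one_degree[D cutZ].
have [B BE] := finite_linear_system (fun u : 'rV[k]_(word_count r D.+1) =>
  forall lam, in_cone Z lam -> u *m veronese D.+1 lam = 0).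
exists D, B; split=> [y /BE By0|lam lam0].
  by apply: symmetric_tensor_of_veronese => u u0; apply: By0 => lam _; apply: u0.
split=> [/BE Blam|Zlam]; last by apply/BE => u; apply.
have dimlam : \dim <[lam]>%VS == 1%N by rewrite dim_vline lam0.
pose x : proj k r := exist _ <[lam]>%VS dimlam.
have xlam : val x = <[lam]>%VS by [].
exists x => //; apply: cutZ => p homp vanp; rewrite (vanishes_at_line homp xlam).
have [u up] := form_as_row homp.
have := Blam u; rewrite up => /(_ _)/(congr1 (fun M : 'M_1 => M 0 0)).
rewrite !mxE eqxx; apply=> mu [z Zz zmu].
by rewrite up (vanp z Zz mu) ?zmu ?memv_line // raddf0.
Qed.

Section Isomorphism.
Variables (k : fieldType) (r : nat) (V : projective_variety k r).
Variables (D : nat) (B : 'M[k]_(word_count r D.+1)).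
Hypothesis symB : forall y, B *m y = 0 -> symmetric_tensor y.
Hypothesis cutB : forall lam,
  lam != 0 -> B *m veronese D.+1 lam = 0 <-> in_cone (variety_set V) lam.

Let W := eigenvector_variety (veronese_pencil_reduced B).

(** The graph of the isomorphism.  Both maps are extracted from it by choice, so
    that everything about them follows from this relation between lines. *)
Definition veronese_related (x : points W) (z : points V) :=
  exists lam, line_of z = <[lam]>%VS /\ line_of x = <[veronese D.+1 lam]>%VS.

Lemma line_of_neq0 s (U : projective_variety k s) (z : points U) v :
  line_of z = <[v]>%VS -> v != 0.
Proof.
move=> zv; apply: (@in_cone_neq0 _ _ (variety_set U)).
by exists (sval z) => //; apply: svalP.
Qed.

Lemma veronese_related_total_l x : exists z, veronese_related x z.
Proof.
case: x => x Wx; have [y eig_y xy] := Wx.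
have [By0 [lam lam0 [c c0 yc]]] := eigenvector_veronese (@symB y) eig_y.
have Blam : B *m veronese D.+1 lam = 0.
  by apply: (scalerI c0); rewrite scaler0 scalemxAr -yc.
have [z Vz zlam] := (cutB lam0).1 Blam.
exists (exist _ z Vz), lam; split=> //.
by rewrite /line_of /= xy yc vlineZ.
Qed.

Lemma veronese_related_total_r z : exists x, veronese_related x z.
Proof.
have [lam lam0 zlam] := proj_line (sval z).
have Blam : B *m veronese D.+1 lam = 0.
  by apply/cutB => //; exists (sval z) => //; apply: svalP.
have dimx : \dim <[veronese D.+1 lam]>%VS == 1%N by rewrite dim_vline veronese_neq0.
have Wx : variety_set W (exist _ <[veronese D.+1 lam]>%VS dimx).
  by exists (veronese D.+1 lam) => //; apply: veronese_eigenvector.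
by exists (exist _ _ Wx), lam.
Qed.

Lemma veronese_related_inj_l x x' z :
  veronese_related x z -> veronese_related x' z -> x = x'.
Proof.
move=> [lam [zlam xlam]] [mu [zmu xmu]]; apply: points_inj.
by rewrite xlam xmu; apply: veronese_lineZ; rewrite -zlam.
Qed.

Lemma veronese_related_inj_r x z z' :
  veronese_related x z -> veronese_related x z' -> z = z'.
Proof.
move=> [lam [zlam xlam]] [mu [zmu xmu]]; apply: points_inj.
rewrite zlam zmu; apply: (@veronese_line_inj _ _ D); last by rewrite -xlam.
exact: line_of_neq0 zlam.
Qed.

(** Near the point of the d-th power of lam with lam_i nonzero, the map is the
    linear projection to the coordinates j :: w with w the constant word i^D; the
    neighbourhood is where the coordinate i :: w does not vanish. *)
Lemma veronese_related_morphism_l (f : points W -> points V) :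
  (forall x, veronese_related x (f x)) -> is_morphism f.
Proof.
move=> fP x; have [lam [zlam xlam]] := fP x.
have [i li0] := nz_col_entry (line_of_neq0 zlam).
pose F j := linear_form (word_row k D.+1 (j :: nseq D i)).
exists (fun x => ~ vanishes_at (F i) x), 1%N, F; split.
- exact: zariski_open_neq0 (linear_form_homog _).
- rewrite (vanishes_at_line (linear_form_homog _) xlam) eval_linear_form.
  rewrite -/(coord _ _) coord_veronese /= ?size_nseq // /word_eval big_cons.
  rewrite -/(word_eval _ _) word_eval_nseq -exprS => /eqP.
  by rewrite (negPf (expf_neq0 _ _)).
- by move=> j; apply: linear_form_homog.
move=> y Uy v yv; have [mu [zmu ymu]] := fP y.
have [c c0 vc] : exists2 c, c != 0 & v = c *: veronese D.+1 mu.
  by apply: eq_vlineP; rewrite -yv.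
have Fv : \col_j eval_at (F j) v = (c * word_eval mu (nseq D i)) *: mu.
  rewrite -(coord_row_veronese c mu (size_nseq D i)) -vc.
  by apply/colP => j; rewrite !mxE eval_linear_form.
rewrite Fv zmu vlineZ //; apply/eqP => e0; apply: Uy.
rewrite (vanishes_at_line (linear_form_homog _) yv).
by have /colP/(_ i) := Fv; rewrite e0 scale0r !mxE.
Qed.

Lemma veronese_related_morphism_r (g : points V -> points W) :
  (forall z, veronese_related (g z) z) -> is_morphism g.
Proof.
move=> gP z; exists (fun _ => True), D.+1, (fun i => word_form k (word i)).
split=> [||i|y _ v yv] //; first exact: zariski_openT.
  by rewrite -[X in X.-homog](size_tuple (word i)); apply: word_form_homog.
have [mu [ymu gymu]] := gP y.
rewrite gymu (_ : \col_i _ = veronese D.+1 v).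
  by apply: veronese_lineZ; rewrite -ymu.
by apply/colP => i; rewrite !mxE eval_word_form.
Qed.

Lemma veronese_pencil_isomorphic : isomorphic W V.
Proof.
have [f fP] := choice veronese_related_total_l.
have [g gP] := choice veronese_related_total_r.
exists f, g; split.
- exact: veronese_related_morphism_l.
- exact: veronese_related_morphism_r.
- by move=> x; apply: veronese_related_inj_l (gP _) (fP x).
- by move=> z; apply: veronese_related_inj_r (fP _) (gP z).
Qed.

End Isomorphism.

Theorem theorem1 (k : closedFieldType) (r : nat) (V : projective_variety k r) :
  exists (n a b : nat) (P : pencil k n a b) (redP : reduced P),
    isomorphic (eigenvector_variety redP) V.
Proof.
have [D [B [symB cutB]]] := veronese_equations (variety_closed V).
exists r.+1, (word_count r D.+1), (word_count r D + word_count r D.+1)%N.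
exists (veronese_pencil B), (veronese_pencil_reduced B).
exact: veronese_pencil_isomorphic.
Qed.
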